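(* Let $h>0$, let $p_1,p_2,p_3,p_4>0$ with $\sum_{l=1}^4 p_l=1$, and assume $|p_1-p_3|+|p_2-p_4|\neq 0$. Let $e\in h\mathbb{Z}^2$ be the source site and let $\lambda_n(w)$ be the time-averaged number of particles at site $w$ in the particle system described in the context, where $\mathbb{E}\alpha_n=\alpha h\in(0,\infty)$. Then for every $w\in h\mathbb{Z}^2$, $\lambda_n(w)\to h\alpha\,\mathbb{E}_e[\ell_\infty(w)]$ in $L^1(\mathbb{P})$ as $n\to\infty$.
   Context: Let $e_1=(1,0)'$, $e_2=(0,1)'$, $e_3=-e_1$, $e_4=-e_2$ (the unsubscripted $e$ is a separate object, a point of $h\mathbb{Z}^2$). For $v\in h\mathbb{Z}^2$, $\mathbb{P}_v$ is the probability measure on $(h\mathbb{Z}^2)^\infty$ under which the canonical coordinate sequence $(X_n)_{n\ge 0}$ is the Markov chain with $X_0=v$ a.s. and transition probabilities $\mathbb{P}_v[X_n=x+he_l\mid X_{n-1}=x]=p_l$, $l=1,\dots,4$; $\mathbb{E}_v$ is the corresponding expectation. For $v_1,v_2\in h\mathbb{Z}^2$, $\delta_{v_1}(v_2)=1$ if $v_1=v_2$ and $0$ otherwise, and $\ell_\infty(w)=\sum_{n=0}^\infty\delta_w(X_n)$. Particle system: on a probability space $(\Omega,\mathcal{F},\mathbb{P})$ with expectation $\mathbb{E}$, let $(\alpha_n)_{n\ge 0}$ be i.i.d. random variables with values in the nonnegative integers and $\mathbb{E}\alpha_n=\alpha h\in(0,\infty)$; $\alpha_n$ is the number of particles injected at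 the source $e$ at time $nh$. For $n\geq 0$, $i\ge 1$, let $X^{(n,i)}=(X^{(n,i)}_j)_{j\ge 0}$ be the random walk of the $i$-th particle introduced at time $nh$; the sequences $X^{(n,i)}$ are mutually independent, independent of $(\alpha_n)_{n\ge0}$, and each has the law of $(X_j)_{j\ge 0}$ under $\mathbb{P}_e$. For $w\in h\mathbb{Z}^2$ and $n\ge 0$, the number of particles at $w$ at time $nh$ is $$N_n(w)=\sum_{j=0}^n\sum_{i=1}^{\alpha_j}\delta_w\big(X^{(j,i)}_{n-j}\big),$$ and for $n\ge1$, $\lambda_n(w)=\frac1n\sum_{m=0}^{n-1}N_m(w)$. *)

(* Defs.v *)
From HB Require Import structures.
From mathcomp Require Import all_boot all_order all_algebra.
From mathcomp Require Import all_classical all_reals all_analysis.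

Set Implicit Arguments.
Unset Strict Implicit.
Unset Printing Implicit Defensive.

Import Order.TTheory GRing.Theory Num.Theory.
Import numFieldNormedType.Exports.

Local Open Scope classical_set_scope.
Local Open Scope ring_scope.

(* Directions (and the associated transition probabilities) are indexed from 0:
   [dir 0], [dir 1], [dir 2], [dir 3] are e_1, e_2, e_3 = - e_1, e_4 = - e_2. *)
Definition dir (R : realType) (l : 'I_4) : 'cV[R]_2 :=
  tnth [tuple delta_mx 0 0; delta_mx 1 0; - delta_mx 0 0; - delta_mx 1 0] l.

Definition hZ2 (R : realType) (h : R) : set 'cV[R]_2 :=
  [set h *: map_mx intr z | z in [set: 'cV[int]_2]].

Definition site (R : realType) (h : R) : Type := set_type (hZ2 h).

Lemma hZ2_0 (R : realType) (h : R) : 0 \in hZ2 h.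
Proof. by apply/mem_set; exists 0 => //; rewrite map_mx0 scaler0. Qed.

HB.instance Definition _ (R : realType) (h : R) :=
  SubChoice.copy (site h) (set_type (hZ2 h)).
HB.instance Definition _ (R : realType) (h : R) :=
  isPointed.Build (site h) (exist _ 0 (hZ2_0 h)).

(* The path space (h Z^2)^oo, with the sigma-algebra generated by the
   coordinate maps; h Z^2 is countable, so that singletons suffice. *)
Definition cylinders (R : realType) (h : R) : set (set (nat -> site h)) :=
  [set A | exists n v, A = [set x | x n = v]].

Definition path_space (R : realType) (h : R) := g_sigma_algebraType (@cylinders R h).

HB.instance Definition _ (R : realType) (h : R) := Measurable.on (path_space h).

Definition cond_prob d (T : measurableType d) (R : realType)
    (P : probability T R) (A B : set T) : R :=
  fine (P (A `&` B)) / fine (P B).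

(* [walk_law p v Pv]: under [Pv] the coordinate sequence is the Markov chain
   started from [v] whose jump [h *: dir l] has probability [p l]. *)
Definition walk_law (R : realType) (h : R) (p : 'I_4 -> R) (v : site h)
    (Pv : probability (path_space h) R) : Prop :=
  [/\ Pv [set x | x 0%N = v] = 1%E,
      forall (n : nat) (y : nat -> site h) (z : site h),
        let past := [set x : path_space h | forall k, (k <= n)%N -> x k = y k] in
        Pv past != 0%E ->
        cond_prob Pv [set x | x n.+1 = z] past =
        cond_prob Pv [set x | x n.+1 = z] [set x | x n = y n]
    & forall (n : nat) (y : site h) (l : 'I_4),
        Pv [set x | x n = y] != 0%E ->
        cond_prob Pv [set x | val (x n.+1) = val y + h *: dir R l]
                     [set x | x n = y] = p l].

Definition delta (R : realType) (h : R) (v1 v2 : site h) : R := (v1 == v2)%:R.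

Definition local_time (R : realType) (h : R) (w : site h) (x : path_space h) : \bar R :=
  (\sum_(0 <= n <oo) (delta w (x n))%:E)%E.

Definition mutually_independent d d' (T : measurableType d) (T' : measurableType d')
    (R : realType) (P : probability T R) (I : choiceType) (X : I -> T -> T') : Prop :=
  forall (s : seq I) (B : I -> set T'), uniq s ->
    (forall i, i \in s -> measurable (B i)) ->
    P (\bigcap_(i in [set` s]) (X i @^-1` B i)) = (\prod_(i <- s) P (X i @^-1` B i))%E.

Definition sigma_family d d' (T : measurableType d) (T' : measurableType d')
    (I : Type) (X : I -> T -> T') : set (set T) :=
  <<s \bigcup_i preimage_set_system setT (X i) measurable >>.

Definition independent_families d d1 d2 (T : measurableType d)
    (T1 : measurableType d1) (T2 : measurableType d2)
    (R : realType) (P : probability T R) (I J : Type)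
    (X : I -> T -> T1) (Y : J -> T -> T2) : Prop :=
  forall A B : set T, sigma_family X A -> sigma_family Y B ->
    P (A `&` B) = (P A * P B)%E.

(* The particles entering at time [n h] are numbered from 0, so that [W n i] is
   the trajectory of the [i.+1]-th of the [a n] particles. *)
Definition nb_particles (R : realType) (h : R) (T : Type) (a : nat -> T -> nat)
    (W : nat -> nat -> T -> path_space h) (n : nat) (w : site h) (x : T) : R :=
  \sum_(j < n.+1) \sum_(i < a j x) delta w (W j i x (n - j)%N).

Definition mean_nb_particles (R : realType) (h : R) (T : Type) (a : nat -> T -> nat)
    (W : nat -> nat -> T -> path_space h) (n : nat) (w : site h) (x : T) : R :=
  n%:R^-1 * \sum_(m < n) nb_particles a W m w x.

Definition cvg_L1 d (T : measurableType d) (R : realType) (P : probability T R)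
    (f : nat -> T -> \bar R) (g : T -> \bar R) : Prop :=
  [/\ forall n, P.-integrable setT (f n),
      P.-integrable setT g
    & (fun n => \int[P]_x `|f n x - g x|)%E @ \oo --> 0%E].

(* Main.v *)
Require Import Defs.
From mathcomp Require Import all_boot all_order all_algebra.
From mathcomp Require Import all_classical all_reals all_analysis.
From mathcomp Require Import measurable_realfun ring lra.
Import Order.TTheory GRing.Theory Num.Theory.
Import numFieldNormedType.Exports.

Local Open Scope classical_set_scope.
Local Open Scope ring_scope.

(** Two ingredients: the walk is transient, and particles entering at different
    times are independent.

    Transience.  Some coordinate of the walk has a nonzero drift, so for a
    suitable exponential weight the mean of the weight of one jump is a number
    phi < 1 ([tilted_jump_lt1]).  Since the probability of being at y at time
    n + 1 is at most the p-weighted sum of the probabilities of being at the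
    neighbours of y at time n ([prob_step]), induction on n bounds the
    probability of being at w at time n by a constant times phi ^ n
    ([prob_le_tilt]).  Hence G, the expected number of visits to w, is finite
    ([green_finite]).

    Law of large numbers.  Let A j i r be the event that the i-th particle of
    time j exists and is at w at age r.  It has probability t_i g_r with
    sum_i t_i = alpha h and sum_r g_r = G, and the events of different entry
    times are independent in pairs.  Write c = alpha h G.  Grouping the
    particles by entry time shows that the mean of lambda_n is at most c.
    Because of this one-sided bound,
      E|lambda_n - c| = 2 E(c - lambda_n)^+ + E lambda_n - c
                     <= 2 E(c - lambda_n)^+,
    so that only a lower bound on lambda_n is needed.  For this it suffices to
    keep, of each of the first n - K groups, the first K particles during their
    first K units of life: a sum of bounded terms, independent in pairs, of
    mean y_K = (sum_(i < K) t_i) (sum_(r < K) g_r) each, whose variance is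
    O(n).  The truncation is what allows a variance argument, since alpha_n may
    have an infinite second moment.  Letting n and then K grow gives the
    theorem, because y_K tends to c.  The two steps are [average_L1_bound] and
    [average_cvg_L1]. *)

Set Implicit Arguments.
Unset Strict Implicit.
Unset Printing Implicit Defensive.

(** * Jumps of the walk and exponential weights *)

(** With u, v the square roots of a and b, the minimum over s is 2 u v, reached
    when the exponential of s is v / u, and 2 u v < u ^ 2 + v ^ 2. *)
Lemma tilt_lt (R : realType) (a b : R) : 0 < a -> 0 < b -> a != b ->
  exists s, a * expR s + b * expR (- s) < a + b.
Proof.
move=> a0 b0 ab.
have [u0 v0] : 0 < Num.sqrt a /\ 0 < Num.sqrt b by rewrite !sqrtr_gt0.
have uE := sqr_sqrtr (ltW a0); have vE := sqr_sqrtr (ltW b0).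
set u := Num.sqrt a in u0 uE *; set v := Num.sqrt b in v0 vE *.
exists (ln (v / u)); rewrite expRN lnK ?posrE ?divr_gt0//.
have -> : a * (v / u) + b * (v / u)^-1 = 2 * (u * v).
  by rewrite -uE -vE; field; rewrite !gt_eqF.
have uv : u - v != 0 by apply: contra_neq ab => /subr0_eq uv; rewrite -uE -vE uv.
have : 0 < (u - v) ^+ 2 by rewrite exprn_even_gt0.
by rewrite -uE -vE; nra.
Qed.

Lemma sum_ord4 (R : realType) (F : 'I_4 -> R) :
  \sum_(l < 4) F l = F 0 + F 1 + F 2 + F 3.
Proof.
rewrite !big_ord_recr big_ord0 /= add0r.
by do 3?[congr (_ + _)]; congr F; apply/val_inj.
Qed.

(** The two jumps orthogonal to the coordinate with drift have weight 1, and
    [tilt_lt] handles the other two. *)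
Lemma tilted_jump_lt1 (R : realType) (p : 'I_4 -> R) :
  (forall l, 0 < p l) -> \sum_(l < 4) p l = 1 ->
  `|p 0 - p 2| + `|p 1 - p 3| != 0 ->
  exists (i : 'I_2) (s : R), \sum_(l < 4) p l * expR (s * dir R l i 0) < 1.
Proof.
move=> p0; rewrite sum_ord4 => p1 drift.
have [p02|p02] := eqVneq (p 0) (p 2).
- have p13 : p 1 != p 3.
    by apply: contra_neq drift => p13; rewrite p02 p13 !subrr normr0 addr0.
  have [s hs] := tilt_lt (p0 1) (p0 3) p13.
  exists 1, s; rewrite sum_ord4 /dir !(tnth_nth 0)/= !mxE/=.
  rewrite ?oppr0 ?mulr0 ?mulr1 ?mulrN1 ?expR0.
  lra.
- have [s hs] := tilt_lt (p0 0) (p0 2) p02.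
  exists 0, s; rewrite sum_ord4 /dir !(tnth_nth 0)/= !mxE/=.
  rewrite ?oppr0 ?mulr0 ?mulr1 ?mulrN1 ?expR0.
  lra.
Qed.

(** The linear form v_0 + 2 v_1 takes the values 1, 2, - 1, - 2 on the four
    directions. *)
Lemma dir_inj (R : realType) : injective (dir R).
Proof.
move=> l m /(congr1 (fun v : 'cV[R]_2 => v 0 0 + 2 * v 1 0)).
rewrite /dir !(tnth_nth 0).
case: l m => [[|[|[|[|//]]]] ?] [[|[|[|[|//]]]] ?]; rewrite /= !mxE /= => lm;
  by [exact: val_inj|exfalso; lra].
Qed.

(** * Events of the path space *)

Lemma countable_site (R : realType) (h : R) : countable [set: site h].
Proof.
rewrite (eq_countable (card_setT _)).
exact: card_le_trans (card_image_le _ _) (countableP _).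
Qed.

Lemma measurable_coord (R : realType) (h : R) (n : nat) (S : set (site h)) :
  measurable [set x : path_space h | S (x n)].
Proof.
have -> : [set x : path_space h | S (x n)] =
    \bigcup_(v : site h) [set x : path_space h | x n = v /\ S v].
  by apply/seteqP; split=> x /= => [Sx|[v _ [<-]]//]; exists (x n).
apply: countable_bigcupT_measurable => [|v]; first exact: countable_site.
have [Sv|nSv] := pselect (S v).
  rewrite (_ : mkset _ = [set x | x n = v]); last by apply/seteqP; split=> x //= [].
  by apply: sub_gen_smallest; exists n, v.
by rewrite (_ : mkset _ = set0)//; apply/seteqP; split=> x //= [].
Qed.

(** The sites have no given enumeration: an injection f into the naturals turns
    the union into one indexed by the naturals, over the fibres of f, each of
    which has at most one element. *)
Lemma negligible_site_bigcup (R : realType) (h : R) d (T : measurableType d)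
    (mu : {measure set T -> \bar R}) (F : site h -> set T) :
  (forall v, mu.-negligible (F v)) -> mu.-negligible (\bigcup_v F v).
Proof.
move=> F0; have /countable_injP[f f_inj] := countable_site h.
apply: (@negligibleS _ _ _ _ (\bigcup_k \bigcup_(v in [set v | f v = k]) F v)).
  by move=> x [v _ Fvx]; exists (f v) => //; exists v.
apply: negligible_bigcup => k.
have [[v vk]|nk] := pselect (exists v, f v = k); last first.
  apply: (@negligibleS _ _ _ _ set0); last exact: negligible_set0.
  by move=> x [v vk _]; apply: nk; exists v.
apply: (@negligibleS _ _ _ _ (F v)) => // x [v' v'k].
by rewrite (f_inj v' v) ?inE// v'k.
Qed.

Lemma bigsetU_ord (T : Type) n (F : 'I_n -> set T) :
  \big[setU/set0]_(l < n) F l = \bigcup_l F l.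
Proof.
apply/seteqP; split => [x|x [l _ Flx]]; last by rewrite (bigD1 l)//=; left.
by elim/big_ind: _ => [//|A B sA sB []//|l _ Flx]; exists l.
Qed.

Lemma delta_coord (R : realType) (h : R) (w : site h) r (x : path_space h) :
  delta w (x r) = \1_[set x : path_space h | x r = w] x.
Proof.
rewrite /delta indicE eq_sym; congr (_%:R); congr nat_of_bool.
by apply/eqP/idP => [xw|]; [exact/mem_set|move/set_mem].
Qed.

(** * Transience *)

Section hitting.
Variables (R : realType) (h : R) (p : 'I_4 -> R) (e : site h).
Variable Pe : probability (path_space h) R.
Hypotheses (h_gt0 : 0 < h) (p_ge0 : forall l, 0 <= p l) (p_sum1 : \sum_(l < 4) p l = 1).
Hypothesis Pe_law : walk_law p e Pe.

Let jump n z l : set (path_space h) :=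
  [set x | val (x n.+1) = val z + h *: dir R l] `&` [set x | x n = z].

Let mjump n z l : measurable (jump n z l).
Proof.
apply: measurableI; last exact: (measurable_coord n [set z]).
exact: (measurable_coord n.+1 [set v | val v = val z + h *: dir R l]).
Qed.

Lemma prob_jump n z l : Pe (jump n z l) = ((p l)%:E * Pe [set x | x n = z])%E.
Proof.
have mz : measurable [set x : path_space h | x n = z].
  exact: (measurable_coord n [set z]).
have [z0|z0] := eqVneq (Pe [set x | x n = z]) 0%E.
  rewrite z0 mule0; apply/eqP; rewrite eq_le measure_ge0 andbT -z0.
  apply: le_measure; rewrite ?inE//; last by move=> x [].
have [_ _ /(_ n z l z0)] := Pe_law; rewrite /cond_prob => <-.
have fz : Pe [set x | x n = z] \is a fin_num by exact: fin_num_measure.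
have fz0 : fine (Pe [set x | x n = z]) != 0 by rewrite fine_eq0.
rewrite -[X in (_ * X)%E]fineK// -EFinM divfK// fineK// fin_num_measure//.
exact: mjump.
Qed.

(** The four jumps from z are disjoint events whose probabilities add up to
    that of being at z. *)
Lemma step_in_dirs n z :
  Pe ([set x | x n = z] `\` \big[setU/set0]_(l < 4) jump n z l) = 0%E.
Proof.
have mz : measurable [set x : path_space h | x n = z].
  exact: (measurable_coord n [set z]).
have fz : Pe [set x | x n = z] \is a fin_num by exact: fin_num_measure.
have mU : measurable (\big[setU/set0]_(l < 4) jump n z l).
  by apply: bigsetU_measurable.
have PU : Pe (\big[setU/set0]_(l < 4) jump n z l) = Pe [set x | x n = z].
  rewrite measure_bigsetU_ord//; last first.
    move=> l m _ _ [x [[jl _] [jm _]]]; apply: (@dir_inj R).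
    by apply: (scalerI (lt0r_neq0 h_gt0)); apply: (addrI (val z)); rewrite -jl.
  rewrite (eq_bigr (fun l => (p l * fine (Pe [set x | x n = z]))%:E)).
    by rewrite sumEFin -mulr_suml p_sum1 mul1r fineK.
  by move=> l _; rewrite EFinM fineK//; exact: prob_jump.
rewrite measureD//; last by rewrite ltey_eq fz.
rewrite setIidr; last by rewrite bigsetU_ord => x [l _ []].
by rewrite [X in (_ - X)%E]PU subee.
Qed.

(** Up to the null event of [step_in_dirs], summed over the countably many
    positions at time n, reaching y takes one of the four jumps. *)
Lemma prob_step n y : (Pe [set x | x n.+1 = y] <=
  \sum_(l < 4) (p l)%:E * Pe [set x | val (x n) = (val y - h *: dir R l)%R])%E.
Proof.
pose B l := [set x : path_space h | val (x n) = (val y - h *: dir R l) /\ x n.+1 = y].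
have mB l : measurable (B l).
  apply: measurableI; last exact: (measurable_coord n.+1 [set y]).
  exact: (measurable_coord n [set v | val v = val y - h *: dir R l]).
have BE l : (Pe (B l) <= (p l)%:E * Pe [set x | val (x n) = (val y - h *: dir R l)%R])%E.
  have [[z zE]|nz] := pselect (exists z : site h, val z = val y - h *: dir R l).
    rewrite -zE (_ : [set x | _ = val z] = [set x : path_space h | x n = z]).
      rewrite -prob_jump; apply: le_measure; rewrite ?inE//.
      move=> x [xz xy]; split; last by apply: val_inj; rewrite [LHS]xz zE.
      by apply: (etrans (congr1 val xy)); rewrite zE subrK.
    by apply/seteqP; split=> x /= => [/val_inj|->].
  rewrite (_ : B l = set0) ?measure0.
    by apply: mule_ge0 => //; rewrite lee_fin.
  by apply/seteqP; split => // x [xz _]; apply: nz; exists (x n).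
have my : measurable [set x : path_space h | x n.+1 = y].
  exact: (measurable_coord n.+1 [set y]).
have mU : measurable (\big[setU/set0]_(l < 4) B l) by exact: bigsetU_measurable.
have N0 : Pe.-negligible ([set x | x n.+1 = y] `\` \big[setU/set0]_(l < 4) B l).
  pose F z := [set x : path_space h | x n = z] `\` \big[setU/set0]_(l < 4) jump n z l.
  apply: (@negligibleS _ _ _ _ (\bigcup_z F z)); last first.
    apply: negligible_site_bigcup => z; exists (F z); split => //.
      apply: measurableD; first exact: (measurable_coord n [set z]).
      exact: bigsetU_measurable.
    exact: step_in_dirs.
  move=> x [/= xy nB]; exists (x n) => //; split => //=.
  rewrite bigsetU_ord => -[l _ [jl _]]; apply: nB; rewrite bigsetU_ord.
  by exists l => //; split => //; rewrite -xy jl addrK.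
move/negligibleP : N0 => N0.
rewrite (measureDI Pe my mU) N0 ?add0e; last exact: measurableD.
apply: (@le_trans _ _ (\sum_(l < 4) Pe (B l))%E); last exact: lee_sum.
apply: (@le_trans _ _ (Pe (\big[setU/set0]_(l < 4) B l))).
  by apply: le_measure; rewrite ?inE//; exact: measurableI.
have := @Boole_inequality _ _ _ Pe (fun k => B (inord k)) 4 (fun k _ => mB _).
by under eq_bigr do rewrite inord_val; under [in leRHS]eq_bigr do rewrite inord_val.
Qed.

(** A bound over sites extends to vectors, such as the neighbours y - h e_l in
    [prob_step]: at a vector outside the lattice the event is empty. *)
Lemma prob_coord_le n (v : 'cV[R]_2) (c : R) : 0 <= c ->
  (forall y : site h, val y = v -> (Pe [set x | x n = y] <= c%:E)%E) ->
  (Pe [set x | val (x n) = v] <= c%:E)%E.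
Proof.
move=> c0 yc; have [[y yv]|nv] := pselect (exists y : site h, val y = v).
  rewrite (_ : mkset _ = [set x : path_space h | x n = y]); first exact: yc.
  by apply/seteqP; split=> x /= => [xv|->//]; apply: val_inj; rewrite [LHS]xv yv.
rewrite (_ : mkset _ = set0) ?measure0 ?lee_fin//.
by apply/seteqP; split => // x xv; apply: nv; exists (x n).
Qed.

(** A supermartingale argument in elementary form: the bound is stable under
    [prob_step], because moving from y to y - h e_l multiplies the exponential
    by the weight of e_l. *)
Lemma prob_le_tilt (i : 'I_2) (s : R) n (y : site h) :
  (Pe [set x | x n = y] <=
     ((\sum_(l < 4) p l * expR (s * dir R l i 0)) ^+ n *
      expR (s * ((val e - val y) i 0 / h)))%:E)%E.
Proof.
set phi := \sum_(l < 4) _; have phi0 : 0 <= phi.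
  by apply: sumr_ge0 => l _; rewrite mulr_ge0 ?expR_ge0.
elim: n y => [|n IHn] y.
  rewrite expr0 mul1r; have [Pe0 _ _] := Pe_law.
  have [->|ye] := eqVneq y e.
    by rewrite subrr mxE mul0r mulr0 expR0 Pe0.
  rewrite (_ : Pe _ = 0%E) ?lee_fin ?expR_ge0//.
  apply/eqP; rewrite eq_le measure_ge0 andbT.
  have me : measurable [set x : path_space h | x 0%N = e].
    exact: (measurable_coord 0 [set e]).
  have -> : 0%E = Pe (~` [set x | x 0%N = e]).
    by rewrite probability_setC// Pe0 subee.
  apply: le_measure; rewrite ?inE.
  - exact: (measurable_coord 0 [set y]).
  - exact: measurableC.
  - by move=> x /= -> /eqP; apply/negP.
apply: (le_trans (prob_step n y)).
rewrite exprS -mulrA mulr_suml -sumEFin; apply: lee_sum => l _.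
rewrite -mulrA EFinM lee_wpmul2l ?lee_fin//.
apply: prob_coord_le => [|z zE]; first by rewrite !mulr_ge0 ?expR_ge0 ?exprn_ge0.
apply: le_trans (IHn z) _; rewrite lee_fin zE [leRHS]mulrCA ler_wpM2l ?exprn_ge0//.
rewrite -expRD le_eqVlt; apply/orP; left; apply/eqP; congr expR.
rewrite !mxE; field; exact: lt0r_neq0.
Qed.

End hitting.

(** Comparison with the geometric series given by [prob_le_tilt]; the sum is the
    Green function of the walk at w. *)
Lemma green_finite (R : realType) (h : R) (p : 'I_4 -> R) (e w : site h)
    (Pe : probability (path_space h) R) :
  0 < h -> (forall l, 0 < p l) -> \sum_(l < 4) p l = 1 ->
  `|p 0 - p 2| + `|p 1 - p 3| != 0 -> walk_law p e Pe ->
  exists G : R, (\sum_(0 <= n <oo) Pe [set x | x n = w] = G%:E)%E.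
Proof.
move=> h0 p0 p1 drift Pe_law.
have [i [s]] := tilted_jump_lt1 p0 p1 drift.
set phi := \sum_(l < 4) _ => phi1.
have phi0 : 0 < phi.
  rewrite /phi (bigD1 0)//= ltr_pwDl ?mulr_gt0 ?expR_gt0//.
  by apply: sumr_ge0 => l _; rewrite mulr_ge0 ?expR_ge0 ?ltW.
set c := expR (s * ((val e - val w) i 0 / h)).
have gle n : (Pe [set x | x n = w] <= (c * phi ^+ n)%:E)%E.
  rewrite mulrC; exact: (prob_le_tilt h0 (fun l => ltW (p0 l)) p1 Pe_law).
exists (fine (\sum_(0 <= n <oo) Pe [set x | x n = w])%E).
rewrite fineK// ge0_fin_numE; last by apply: nneseries_ge0 => n _ _; exact: measure_ge0.
apply: (@le_lt_trans _ _ (c / (1 - phi))%:E); last exact: ltry.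
apply: lime_le; first by apply: is_cvg_nneseries => n _ _; exact: measure_ge0.
near=> n.
apply: (@le_trans _ _ (\sum_(0 <= k < n) (c * phi ^+ k)%:E)%E).
  by apply: lee_sum => k _; exact: gle.
rewrite sumEFin lee_fin.
by apply: (geometric_le_lim n (expR_ge0 _) phi0); rewrite ger0_norm// ltW.
Unshelve. all: by end_near. Qed.

Lemma integral_local_time (R : realType) (h : R) (w : site h)
    (Pe : probability (path_space h) R) :
  (\int[Pe]_x local_time w x = \sum_(0 <= n <oo) Pe [set x | x n = w])%E.
Proof.
have mw n : measurable [set x : path_space h | x n = w].
  exact: (measurable_coord n [set w]).
rewrite /local_time integral_nneseries//.
- apply: eq_eseriesr => n _; under eq_integral do rewrite delta_coord.
  by rewrite integral_indic// setIT.
- move=> n; apply/measurable_EFinP.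
  by rewrite (_ : (fun x => _) = \1_[set x : path_space h | x n = w]);
    [exact: measurable_indic|apply/funext => x; exact: delta_coord].
- by move=> n x _; rewrite lee_fin /delta.
Qed.

(** * Means of nonnegative random variables *)

Section nonneg_mean.
Context d (T : measurableType d) (R : realType) (P : probability T R).
Implicit Types (f g : T -> R) (a b k : R).

(** Bundling measurability, nonnegativity and a finite real mean lets inequalities
    between means be derived from pointwise ones without side conditions. *)
Definition nonneg_mean f a := [/\ measurable_fun setT f, forall x, 0 <= f x
  & (\int[P]_x (f x)%:E = a%:E)%E].

Lemma nonneg_mean_le f g a b : nonneg_mean f a -> nonneg_mean g b ->
  (forall x, f x <= g x) -> a <= b.
Proof.
move=> [mf f0 fa] [mg g0 gb] fg; rewrite -lee_fin -fa -gb.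
by apply: ge0_le_integral => //; try (by move=> x _; rewrite lee_fin);
  exact/measurable_EFinP.
Qed.

Lemma nonneg_mean_cst k : 0 <= k -> nonneg_mean (fun=> k) k.
Proof.
by move=> k0; split => //; rewrite [LHS]integral_cst// [X in (_ * X)%E]probability_setT mule1.
Qed.

Lemma nonneg_meanD f g a b : nonneg_mean f a -> nonneg_mean g b ->
  nonneg_mean (fun x => f x + g x) (a + b).
Proof.
move=> [mf f0 fa] [mg g0 gb]; split.
- exact: measurable_funD.
- by move=> x; rewrite addr_ge0.
- rewrite EFinD -fa -gb -ge0_integralD//; try (by move=> x _; rewrite lee_fin);
    exact/measurable_EFinP.
Qed.

Lemma nonneg_meanZ k f a : 0 <= k -> nonneg_mean f a ->
  nonneg_mean (fun x => k * f x) (k * a).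
Proof.
move=> k0 [mf f0 fa]; split.
- exact: measurable_funM.
- by move=> x; rewrite mulr_ge0.
- rewrite EFinM -fa -ge0_integralZl_EFin//; try (by move=> x _; rewrite lee_fin);
    exact/measurable_EFinP.
Qed.

Lemma nonneg_mean_sum n (f : 'I_n -> T -> R) (a : 'I_n -> R) :
  (forall i, nonneg_mean (f i) (a i)) ->
  nonneg_mean (fun x => \sum_(i < n) f i x) (\sum_(i < n) a i).
Proof.
move=> fa; split.
- by apply: measurable_sum => i; have [] := fa i.
- by move=> x; apply: sumr_ge0 => i _; have [] := fa i.
- under eq_integral do rewrite -sumEFin.
  rewrite ge0_integral_sum//; last 2 first.
  + by move=> i; apply/measurable_EFinP; have [] := fa i.
  + by move=> i x _; rewrite lee_fin; have [] := fa i.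
  by rewrite -sumEFin; apply: eq_bigr => i _; have [] := fa i.
Qed.

Lemma nonneg_mean_indic (A : set T) a : measurable A -> P A = a%:E ->
  nonneg_mean \1_A a.
Proof.
by move=> mA PA; split => //; rewrite integral_indic// setIT.
Qed.

Lemma nonneg_mean_series (f : nat -> T -> R) g (a : nat -> R) b :
  (forall i, nonneg_mean (f i) (a i)) ->
  (forall x, ((g x)%:E = \sum_(0 <= i <oo) (f i x)%:E)%E) ->
  (\sum_(0 <= i <oo) (a i)%:E = b%:E)%E -> nonneg_mean g b.
Proof.
move=> fa gE ab.
have f0 i x : (0 <= (f i x)%:E)%E by rewrite lee_fin; have [] := fa i.
have mf i : measurable_fun setT (EFin \o f i).
  by apply/measurable_EFinP; have [] := fa i.
split.
- apply/measurable_EFinP; rewrite (_ : _ \o _ = fun x => (\sum_(0 <= i <oo) (f i x)%:E)%E).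
    by apply: ge0_emeasurable_sum => [k x _ _|k _]; [exact: f0|exact: mf].
  by apply/funext => x /=; exact: gE.
- by move=> x; rewrite -lee_fin gE; exact: nneseries_ge0.
- under eq_integral do rewrite gE.
  rewrite integral_nneseries// -ab; apply: eq_eseriesr => i _.
  by have [] := fa i.
Qed.

Lemma nonneg_mean_dominated f g b : measurable_fun setT f ->
  (forall x, 0 <= f x <= g x) -> nonneg_mean g b -> exists a, nonneg_mean f a.
Proof.
move=> mf fg [mg g0 gb]; exists (fine (\int[P]_x (f x)%:E)).
split => // [x|]; first by have /andP[] := fg x.
rewrite fineK// ge0_fin_numE; last first.
  by apply: integral_ge0 => x _; rewrite lee_fin; have /andP[] := fg x.
apply: (@le_lt_trans _ _ b%:E); last exact: ltry.
rewrite -gb; apply: ge0_le_integral => //; try exact/measurable_EFinP;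
  by move=> x _; rewrite lee_fin; have /andP[] := fg x.
Qed.

End nonneg_mean.

(** * Deterministic sums and inequalities *)

(** The first-moment deviation is |l - c| + c - l = 2 (c - l)^+, here bounded by
    2 (c - y) + 2 |y - u|, and 2 |y - u| <= eps + (y - u) ^ 2 / eps.  The terms
    are arranged so that, for nonnegative l, u, y, both sides are sums of
    nonnegative terms, ready to be integrated. *)
Lemma abs_dev_le (R : realFieldType) (l c y u eps : R) :
  0 < eps -> u <= l -> y <= c ->
  `|l - c| + c + (2 * y / eps) * u <=
  l + (2 * (c - y) + eps + y ^+ 2 / eps) + eps^-1 * u ^+ 2.
Proof.
move=> eps0 ul yc.
have sq : 2 * (y - u) <= eps + (y - u) ^+ 2 / eps.
  rewrite -subr_ge0 (_ : _ - _ = (eps - (y - u)) ^+ 2 / eps); last by field; exact: lt0r_neq0.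
  by rewrite divr_ge0 ?sqr_ge0// ltW.
have sq0 : 0 <= (y - u) ^+ 2 / eps by rewrite divr_ge0 ?sqr_ge0// ltW.
have sqE : (y - u) ^+ 2 / eps = y ^+ 2 / eps - (2 * y / eps) * u + eps^-1 * u ^+ 2.
  by field; exact: lt0r_neq0.
rewrite sqE in sq sq0.
by have [lc|lc] := lerP 0 (l - c); [rewrite ger0_norm//|rewrite ltr0_norm//]; lra.
Qed.

Lemma sum_by_entry_time (R : realFieldType) (F : nat -> nat -> R) n :
  \sum_(m < n) \sum_(j < m.+1) F j (m - j)%N = \sum_(j < n) \sum_(r < n - j) F j r.
Proof.
elim: n => [|n IHn]; first by rewrite !big_ord0.
rewrite big_ord_recr/= IHn [in RHS]big_ord_recr/= big_ord_recr/=.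
rewrite addrA subSnn big_ord1 subnn -big_split/=.
by congr (_ + _); apply: eq_bigr => j _; rewrite subSn 1?ltnW// big_ord_recr.
Qed.

Lemma nneseries_finite_support (R : realType) (k : nat) (u : nat -> R) :
  (forall i, 0 <= u i) -> (forall i, (k <= i)%N -> u i = 0) ->
  (\sum_(0 <= i <oo) (u i)%:E = (\sum_(i < k) u i)%:E)%E.
Proof.
move=> u0 uk; rewrite (nneseries_split 0 k)/=; last by move=> i _; rewrite lee_fin.
rewrite add0n [X in (_ + X)%E]eseries0 => [|i ki _]; last by rewrite uk.
by rewrite adde0 big_mkord sumEFin.
Qed.

Lemma partial_sum_le (R : realType) (u : nat -> R) v K : (forall i, 0 <= u i) ->
  (\sum_(0 <= i <oo) (u i)%:E = v%:E)%E -> \sum_(i < K) u i <= v.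
Proof.
move=> u0 uv; rewrite -lee_fin -uv -sumEFin -(big_mkord xpredT (fun i => (u i)%:E)).
by apply: nneseries_lim_ge => i _ _; rewrite lee_fin.
Qed.

Lemma partial_sum_cvg (R : realType) (u : nat -> R) v : (forall i, 0 <= u i) ->
  (\sum_(0 <= i <oo) (u i)%:E = v%:E)%E ->
  (fun K => \sum_(i < K) u i) @ \oo --> v.
Proof.
move=> u0 uv.
have := @is_cvg_nneseries R (fun i => (u i)%:E) xpredT 0%N.
move=> /(_ (fun i _ _ => u0 i)); rewrite uv => /fine_cvgP[_].
apply: cvg_trans; apply: near_eq_cvg; near=> K.
by rewrite /= sumEFin big_mkord.
Unshelve. all: by end_near. Qed.

(** * The law of large numbers for an array of events *)

(** [A j i r]: the i-th particle of time j exists and is at the site of interest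
    at age r; [Z j r] counts the particles of time j that are there at age r. *)
Section particle_array.
Context d (T : measurableType d) (R : realType) (P : probability T R).
Variables (A : nat -> nat -> nat -> set T) (t g : nat -> R) (tau gam : R).
Variable Z : nat -> nat -> T -> R.
Hypothesis mA : forall j i r, measurable (A j i r).
Hypothesis PA : forall j i r, P (A j i r) = (t i * g r)%:E.
Hypothesis PAA : forall j k i i' r r', j != k ->
  P (A j i r `&` A k i' r') = (t i * g r * (t i' * g r'))%:E.
Hypothesis t_ge0 : forall i, 0 <= t i.
Hypothesis g_ge0 : forall r, 0 <= g r.
Hypothesis t_sum : (\sum_(0 <= i <oo) (t i)%:E = tau%:E)%E.
Hypothesis g_sum : (\sum_(0 <= r <oo) (g r)%:E = gam%:E)%E.
Hypothesis ZE : forall j r x, ((Z j r x)%:E = \sum_(0 <= i <oo) (\1_(A j i r) x)%:E)%E.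

Let lam n x : R := n%:R^-1 * \sum_(m < n) \sum_(j < m.+1) Z j (m - j) x.
Let Y K j x : R := \sum_(i < K) \sum_(r < K) \1_(A j i r) x.
Let y K : R := (\sum_(i < K) t i) * (\sum_(r < K) g r).
Let S K m x : R := \sum_(j < m) Y K j x.

Let mean_A j i r : nonneg_mean P \1_(A j i r) (t i * g r).
Proof. exact: nonneg_mean_indic. Qed.

Let mean_Z j r : nonneg_mean P (Z j r) (tau * g r).
Proof.
apply: (nonneg_mean_series (fun i => mean_A j i r) (ZE j r)).
under eq_eseriesr do rewrite mulrC EFinM.
rewrite nneseriesZl ?t_sum; last by move=> i _; rewrite lee_fin.
by rewrite -EFinM mulrC.
Qed.

Let tau_ge0 : 0 <= tau.
Proof. by rewrite -lee_fin -t_sum; apply: nneseries_ge0 => i _ _; rewrite lee_fin. Qed.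

Let gam_ge0 : 0 <= gam.
Proof. by rewrite -lee_fin -g_sum; apply: nneseries_ge0 => i _ _; rewrite lee_fin. Qed.

(** At each time m the groups j = 0, ..., m have the distinct ages m - j, so that
    the mean number of particles at the site is tau times a partial sum of g. *)
Lemma mean_average n :
  exists2 a, nonneg_mean P (lam n) a & a <= tau * gam.
Proof.
exists (n%:R^-1 * \sum_(m < n) \sum_(j < m.+1) tau * g (m - j)%N).
  apply: nonneg_meanZ; first by rewrite invr_ge0.
  apply: nonneg_mean_sum => m; apply: nonneg_mean_sum => j; exact: mean_Z.
case: n => [|n]; first by rewrite big_ord0 mulr0 mulr_ge0.
have sum_cst : n.+1%:R * (tau * gam) = \sum_(m < n.+1) tau * gam.
  by rewrite sumr_const card_ord mulr_natl.
rewrite ler_pdivrMl ?ltr0n// sum_cst; apply: ler_sum => m _.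
rewrite -mulr_sumr ler_wpM2l//.
apply: le_trans (partial_sum_le m.+1 g_ge0 g_sum).
rewrite [leRHS](reindex_inj rev_ord_inj)/=.
by apply: ler_sum => j _; rewrite subSS.
Qed.

Let mean_S K m : nonneg_mean P (S K m) (m%:R * y K).
Proof.
have -> : m%:R * y K = \sum_(j < m) y K by rewrite sumr_const card_ord mulr_natl.
apply: nonneg_mean_sum => j; rewrite /y mulr_suml.
apply: nonneg_mean_sum => i; rewrite mulr_sumr.
exact: nonneg_mean_sum.
Qed.

(** Expand the square.  Two distinct entry times contribute exactly y ^ 2, by
    independence; each of the m diagonal terms is a sum of K ^ 4 probabilities. *)
Let mean_S2 K m : exists2 q, nonneg_mean P (fun x => S K m x ^+ 2) q &
  q <= (m%:R * y K) ^+ 2 + m%:R * K%:R ^+ 4.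
Proof.
pose c j k := \sum_(i < K) \sum_(i' < K) \sum_(r < K) \sum_(r' < K)
   fine (P (A j i r `&` A k i' r')).
exists (\sum_(j < m) \sum_(k < m) c j k).
  have -> : (fun x => S K m x ^+ 2) =
    (fun x => \sum_(j < m) \sum_(k < m) \sum_(i < K) \sum_(i' < K)
     \sum_(r < K) \sum_(r' < K) \1_(A j i r `&` A k i' r') x).
    apply/funext => x; rewrite expr2 /S mulr_suml; apply: eq_bigr => j _.
    rewrite mulr_sumr; apply: eq_bigr => k _.
    rewrite /Y mulr_suml; apply: eq_bigr => i _.
    rewrite mulr_sumr; apply: eq_bigr => i' _.
    rewrite mulr_suml; apply: eq_bigr => r _.
    rewrite mulr_sumr; apply: eq_bigr => r' _.
    by rewrite indicI.
  do 6 (apply: nonneg_mean_sum => ?).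
  by apply: nonneg_mean_indic; [exact: measurableI|
    rewrite fineK// fin_num_measure//; exact: measurableI].
have y_ge0 : 0 <= y K by apply: mulr_ge0; apply: sumr_ge0.
have cle j k : c j k <= y K ^+ 2 + (j == k)%:R * K%:R ^+ 4.
  have [->|jk] := eqVneq j k.
    rewrite mul1r -[leLHS]add0r lerD ?sqr_ge0//.
    have K4 : K%:R ^+ 4 = \sum_(i < K) \sum_(i' < K) \sum_(r < K) \sum_(r' < K) (1 : R).
      by rewrite !sumr_const !card_ord -!mulrnA -natrX.
    rewrite K4; do 4 (apply: ler_sum => ? _).
    rewrite -lee_fin fineK ?probability_le1//; first exact: measurableI.
    by rewrite fin_num_measure//; exact: measurableI.
  rewrite mul0r addr0 le_eqVlt; apply/orP; left; apply/eqP.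
  rewrite expr2 /y [RHS]mulrACA [in RHS]mulr_suml [RHS]mulr_suml.
  apply: eq_bigr => i _; rewrite mulr_sumr [RHS]mulr_suml.
  apply: eq_bigr => i' _; rewrite mulr_suml [RHS]mulr_sumr.
  apply: eq_bigr => r _; rewrite mulr_sumr [RHS]mulr_sumr.
  by apply: eq_bigr => r' _; rewrite PAA//= mulrACA.
have -> : (m%:R * y K) ^+ 2 + m%:R * K%:R ^+ 4 =
    \sum_(j < m) \sum_(k < m) (y K ^+ 2 + (j == k)%:R * K%:R ^+ 4).
  under eq_bigr => j _.
    rewrite big_split/= sumr_const card_ord -mulr_suml (bigD1 j)//= eqxx big1 ?addr0.
      over.
    by move=> k kj; rewrite eq_sym (negbTE kj).
  rewrite sumr_const card_ord mul1r; ring.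
by apply: ler_sum => j _; apply: ler_sum => k _; exact: cle.
Qed.

Let y_le K : y K <= tau * gam.
Proof.
by apply: ler_pM; [exact: sumr_ge0|exact: sumr_ge0|exact: partial_sum_le..].
Qed.

Let y_ge0 K : 0 <= y K.
Proof. by apply: mulr_ge0; exact: sumr_ge0. Qed.

(** Stopping at time m + K leaves each of the first m groups at least K units of
    life. *)
Lemma truncated_le K m x :
  S K m x <= \sum_(n < m + K) \sum_(j < n.+1) Z j (n - j)%N x.
Proof.
have Z0 j r : 0 <= Z j r x by have [_ ->] := mean_Z j r.
rewrite (sum_by_entry_time (fun j r => Z j r x)) big_split_ord/=.
rewrite -[leLHS]addr0 lerD//; last by do 2 apply: sumr_ge0 => ? _.
apply: ler_sum => j _; rewrite /Y exchange_big/=.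
have -> : (m + K - j)%N = (K + (m - j))%N by rewrite addnC addnBA// ltnW.
rewrite big_split_ord/= -[leLHS]addr0 lerD//; last by apply: sumr_ge0.
by apply: ler_sum => r _; apply: (partial_sum_le (u := fun i => \1_(A j i r) x)).
Qed.

(** Integrates [abs_dev_le] with l the average up to time m + K, u the truncated
    sum divided by m + K, and y its per-group mean. *)
Lemma average_L1_bound K m eps : 0 < eps -> (0 < m + K)%N ->
  exists2 a, nonneg_mean P (fun x => `|lam (m + K) x - tau * gam|) a &
  a <= 2 * (tau * gam - y K) + eps +
       (y K ^+ 2 * K%:R ^+ 2 + K%:R ^+ 4) / ((m + K)%:R * eps).
Proof.
move=> eps0 N_gt0; set N := (m + K)%N; set c := tau * gam.
have c0 : 0 <= c by exact: mulr_ge0.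
have N0 : 0 < N%:R :> R by rewrite ltr0n.
have [b lb bc] := mean_average N.
have [ml l0 _] := lb.
have [a fa] : exists a, nonneg_mean P (fun x => `|lam N x - c|) a.
  apply: (nonneg_mean_dominated (g := fun x => lam N x + c)).
  - by apply: measurableT_comp => //; exact: measurable_funB.
  - move=> x; rewrite normr_ge0/=; apply: le_trans (ler_normB _ _) _.
    by rewrite !ger0_norm.
  - exact: nonneg_meanD lb (nonneg_mean_cst P c0).
exists a => //.
have [q Sq qle] := mean_S2 K m.
have k0 : 0 <= 2 * y K / eps by rewrite divr_ge0 ?(ltW eps0)// mulr_ge0 ?y_ge0.
have k1 : 0 <= 2 * (c - y K) + eps + y K ^+ 2 / eps.
  have := y_le K; rewrite -/c => yc.
  have : 0 <= y K ^+ 2 / eps by rewrite divr_ge0 ?sqr_ge0// ltW.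
  lra.
have mu : nonneg_mean P (fun x => N%:R^-1 * S K m x) (N%:R^-1 * (m%:R * y K)).
  by apply: nonneg_meanZ; [rewrite invr_ge0 ltW|].
have mu2 : nonneg_mean P (fun x => (N%:R^-1 * S K m x) ^+ 2) ((N%:R ^+ 2)^-1 * q).
  rewrite (_ : (fun x => (_ * _) ^+ 2) = fun x => (N%:R ^+ 2)^-1 * S K m x ^+ 2).
    by apply: nonneg_meanZ => //; rewrite invr_ge0 sqr_ge0.
  by apply/funext => x; rewrite exprMn exprVn.
have e1 : 0 <= eps^-1 by rewrite invr_ge0 ltW.
have N1 : 0 <= N%:R^-1 :> R by rewrite invr_ge0 ltW.
have key := nonneg_mean_le
  (nonneg_meanD (nonneg_meanD fa (nonneg_mean_cst P c0)) (nonneg_meanZ k0 mu))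
  (nonneg_meanD (nonneg_meanD lb (nonneg_mean_cst P k1)) (nonneg_meanZ e1 mu2))
  (fun x => abs_dev_le eps0 (ler_wpM2l N1 (truncated_le K m x)) (y_le K)).
have q1 : eps^-1 * ((N%:R ^+ 2)^-1 * q) <=
    eps^-1 * ((N%:R ^+ 2)^-1 * ((m%:R * y K) ^+ 2 + m%:R * K%:R ^+ 4)).
  by rewrite !ler_wpM2l ?invr_ge0 ?sqr_ge0// ltW.
suff q2 : y K ^+ 2 / eps - 2 * y K / eps * (N%:R^-1 * (m%:R * y K)) +
    eps^-1 * ((N%:R ^+ 2)^-1 * ((m%:R * y K) ^+ 2 + m%:R * K%:R ^+ 4)) <=
    (y K ^+ 2 * K%:R ^+ 2 + K%:R ^+ 4) / (N%:R * eps).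
  by move: bc key q1 q2; rewrite -/c; lra.
(* The means of u and of u ^ 2 reflect m = N - K groups instead of N: this is
   where the term y ^ 2 K ^ 2 comes from. *)
have -> : (m%:R : R) = N%:R - K%:R by rewrite /N natrD addrK.
rewrite -subr_ge0 (_ : _ - _ =
   (y K ^+ 2 * K%:R ^+ 2 * (N%:R - 1) + K%:R * K%:R ^+ 4) / (N%:R ^+ 2 * eps)); last first.
  by field; rewrite !lt0r_neq0.
have N2 : 0 <= N%:R - 1 :> R by rewrite subr_ge0 ler1n.
apply: divr_ge0; last by rewrite mulr_ge0 ?sqr_ge0 ?(ltW eps0).
by rewrite addr_ge0// mulr_ge0 ?exprn_ge0// mulr_ge0 ?exprn_ge0// y_ge0.
Qed.

(** Given eps, K is chosen first, for c - y_K, and then n, for the variance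
    term. *)
Lemma average_cvg_L1 :
  cvg_L1 P (fun n x => (lam n x)%:E) (fun=> (tau * gam)%:E).
Proof.
split.
- move=> n; have [a [ml l0 la] _] := mean_average n.
  apply/integrableP; split; first exact/measurable_EFinP.
  rewrite (_ : (fun x => _) = fun x => (lam n x)%:E); last first.
    by apply/funext => x; rewrite /= ger0_norm.
  by rewrite la ltry.
- apply/integrableP; split => //.
  by rewrite integral_cst// [X in (_ * X)%E]probability_setT mule1 ltry.
- have dev K m eps (eps0 : 0 < eps) (mK : (0 < m + K)%N) :
      (\int[P]_x `|(lam (m + K) x)%:E - (tau * gam)%:E| <=
       (2 * (tau * gam - y K) + eps +
       (y K ^+ 2 * K%:R ^+ 2 + K%:R ^+ 4) / ((m + K)%:R * eps))%:E)%E.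
    have [a [_ _ fa]] := average_L1_bound eps0 mK.
    by rewrite -lee_fin -fa.
  have ycvg : y K @[K --> \oo] --> tau * gam.
    by apply: cvgM; exact: partial_sum_cvg.
  set u := fun n => _.
  have u0 n : (0 <= u n)%E by apply: integral_ge0.
  have small eps : 0 < eps -> \forall n \near \oo, (u n <= eps%:E)%E.
    move=> eps0; have e4 : 0 < eps / 4 by rewrite divr_gt0.
    have [K _ /(_ K (leqnn K))/= yK] := (cvgrPdist_le _ _).1 ycvg _ e4.
    set C := y K ^+ 2 * K%:R ^+ 2 + K%:R ^+ 4.
    near=> n.
    have Kn : (K < n)%N by near: n; exact: nbhs_infty_gt.
    have -> : n = (n - K + K)%N by rewrite subnK// ltnW.
    apply: (le_trans (dev K (n - K)%N _ e4 _)).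
      by rewrite subnK ?(leq_ltn_trans _ Kn)// ltnW.
    rewrite lee_fin subnK 1?ltnW// -/C.
    have n0 : 0 < n%:R :> R by rewrite ltr0n (leq_ltn_trans _ Kn).
    have nC : C / (eps / 4) / (eps / 4) <= n%:R by near: n; exact: nbhs_infty_ger.
    have : C / (n%:R * (eps / 4)) <= eps / 4.
      rewrite invfM mulrA mulrAC ler_pdivrMr// [leRHS]mulrC.
      by rewrite -ler_pdivrMr.
    have yc : 0 <= tau * gam - y K by rewrite subr_ge0.
    move: yK; rewrite ger0_norm//; lra.
  have ufin : \forall n \near \oo, u n \is a fin_num.
    have := small 1 ltr01; apply: filterS => n un.
    by rewrite ge0_fin_numE// (le_lt_trans un)// ltry.
  apply: cvg_EFin => //; apply/cvgrPdist_le => eps /small ueps.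
  near=> n; rewrite sub0r normrN ger0_norm ?fine_ge0//= -lee_fin fineK.
    by near: n.
  by near: n.
Unshelve. all: by end_near. Qed.

End particle_array.

(** * Independence *)

Lemma mutually_independent_pair d d' (T : measurableType d) (T' : measurableType d')
    (R : realType) (P : probability T R) (I : choiceType) (X : I -> T -> T') i j B C :
  mutually_independent P X -> i != j -> measurable B -> measurable C ->
  P (X i @^-1` B `&` X j @^-1` C) = (P (X i @^-1` B) * P (X j @^-1` C))%E.
Proof.
move=> indep ij mB mC.
pose D k := if k == i then B else C.
have ji : (j == i) = false by rewrite eq_sym (negbTE ij).
have -> : X i @^-1` B `&` X j @^-1` C =
    \bigcap_(k in [set` [:: i; j]]) (X k @^-1` D k).
  apply/seteqP; split=> x.
    move=> [Bx Cx] k; rewrite /= !inE => /orP[|] /eqP ->.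
      by rewrite /D eqxx.
    by rewrite /D ji.
  move=> BCx; split.
    by have := BCx i; rewrite /= !inE eqxx /D eqxx; exact.
  by have := BCx j; rewrite /= !inE eqxx orbT /D ji; exact.
rewrite indep; first by rewrite !big_cons big_nil mule1 /D eqxx ji.
  by rewrite /= inE ij.
by move=> k _; rewrite /D; case: ifP.
Qed.

Lemma sigma_familyI d d' (T : measurableType d) (T' : measurableType d')
    (I : Type) (X : I -> T -> T') A B :
  sigma_family X A -> sigma_family X B -> sigma_family X (A `&` B).
Proof.
move=> sA sB.
have [_ _ _] := (sigma_algebraP (fun D _ => @subsetT _ D)).1
  (smallest_sigma_algebra [set: T] (\bigcup_i preimage_set_system setT (X i) measurable)).
exact.
Qed.

Lemma sigma_family_preimage d d' (T : measurableType d) (T' : measurableType d')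
    (I : Type) (X : I -> T -> T') i B :
  measurable B -> sigma_family X (X i @^-1` B).
Proof.
by move=> mB; apply: sub_sigma_algebra; exists i => //; exists B => //; rewrite setTI.
Qed.

(** * Convergence of the time averages *)

Theorem proposition2p2 (R : realType) (h alpha : R) (p : 'I_4 -> R) (e : site h)
    (Pe : probability (path_space h) R)
    (d : measure_display) (Omega : measurableType d) (P : probability Omega R)
    (a : nat -> {RV P >-> nat}) (W : nat -> nat -> {RV P >-> path_space h})
    (h_gt0 : 0 < h)
    (p_gt0 : forall l, 0 < p l)
    (p_sum1 : \sum_(l < 4) p l = 1)
    (p_drift : `|p 0 - p 2| + `|p 1 - p 3| != 0)
    (Pe_law : walk_law p e Pe)
    (a_indep : mutually_independent P (fun n => a n : Omega -> nat))
    (a_ident : forall n (B : set nat), measurable B ->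
       distribution P (a n) B = distribution P (a 0%N) B)
    (alphah_gt0 : 0 < alpha * h)
    (a_mean : forall n, ('E_P[fun x => (a n x)%:R] = (alpha * h)%:E)%E)
    (W_indep : mutually_independent P
       (fun k : nat * nat => W k.1 k.2 : Omega -> path_space h))
    (W_law : forall n i (B : set (path_space h)), measurable B ->
       distribution P (W n i) B = Pe B)
    (aW_indep : independent_families P (fun n => a n : Omega -> nat)
       (fun k : nat * nat => W k.1 k.2 : Omega -> path_space h)) :
  forall w : site h,
    cvg_L1 P (fun n x => (mean_nb_particles a W n w x)%:E)
      (fun=> ((h * alpha)%:E * \int[Pe]_x local_time w x)%E).
Proof.
move=> w.
have [G GE] := green_finite w h_gt0 p_gt0 p_sum1 p_drift Pe_law.
rewrite integral_local_time GE -EFinM (mulrC h).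
pose B (i : nat) := [set n : nat | (i < n)%N].
pose V (r : nat) := [set x : path_space h | x r = w].
have mV r : measurable (V r) by exact: (measurable_coord r [set w]).
have mB i : measurable (B i) by [].
pose F j i := a j @^-1` B i.
pose H j i r := W j i @^-1` V r.
have mF j i : measurable (F j i) by exact: measurable_funPTI.
have mH j i r : measurable (H j i r) by exact: measurable_funPTI.
pose t i := fine (P (F 0%N i)).
pose g r := fine (Pe (V r)).
have PF j i : P (F j i) = (t i)%:E.
  by rewrite fineK ?fin_num_measure//; exact: (a_ident j _ (mB i)).
have PH j i r : P (H j i r) = (g r)%:E.
  by rewrite fineK ?fin_num_measure//; exact: (W_law j i _ (mV r)).
have sF j i := sigma_family_preimage (X := fun n => a n : Omega -> nat) j (mB i).
have sH j i r := sigma_family_preimage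
  (X := fun k : nat * nat => W k.1 k.2 : Omega -> path_space h) (j, i) (mV r).
have FE j i x : \1_(F j i) x = (i < a j x)%:R :> R.
  by rewrite indicE; congr (_%:R); congr nat_of_bool; apply/idP/idP;
    [move/set_mem|move=> ?; apply/mem_set].
have t0 i : 0 <= t i by rewrite fine_ge0.
have g0 r : 0 <= g r by rewrite fine_ge0.
apply: (@average_cvg_L1 _ _ _ P (fun j i r => F j i `&` H j i r) t g (alpha * h) G
  (fun j r x => \sum_(i < a j x) delta w (W j i x r))) => //.
- by move=> j i r; exact: measurableI.
- by move=> j i r; rewrite aW_indep// ?PF ?PH; [rewrite EFinM|exact: sF|exact: sH].
- move=> j k i i' r r' jk; rewrite setIACA aW_indep; last 2 first.
  + by apply: sigma_familyI; exact: sF.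
  + by apply: sigma_familyI; exact: sH.
  have jik : (j, i) != (k, i') by apply: contra_neq jk => -[].
  transitivity (P (F j i) * P (F k i') * (P (H j i r) * P (H k i' r')))%E.
    congr (_ * _)%E; first exact: (mutually_independent_pair a_indep jk).
    exact: (mutually_independent_pair W_indep jik (mV r) (mV r')).
  by rewrite !PF !PH -!EFinM mulrACA.
(* The mean of a natural number variable is the sum of its tail probabilities. *)
- have := a_mean 0%N; rewrite unlock => <-.
  under eq_eseriesr do rewrite -(PF 0%N) -[F _ _]setIT -integral_indic//.
  rewrite -integral_nneseries//.
  + apply: eq_integral => x _.
    rewrite (nneseries_finite_support (k := a 0%N x))// => [|i ai].
      congr EFin; rewrite -[RHS]mulr1n -[in RHS](card_ord (a 0%N x)) -sumr_const.
      by apply: eq_bigr => i _; rewrite FE ltn_ord.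
    by rewrite FE ltnNge ai.
  + by move=> i; apply/measurable_EFinP; exact: measurable_indic.
- by rewrite -GE; apply: eq_eseriesr => r _; rewrite fineK ?fin_num_measure.
- move=> j r x.
  rewrite (nneseries_finite_support (k := a j x))// => [|i ai].
    congr EFin; apply: eq_bigr => i _; rewrite indicI/= FE ltn_ord mul1r.
    exact: delta_coord.
  by rewrite indicI/= FE ltnNge ai mul0r.
Qed.
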